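(* Let $n\ge 3$ and $0\le r\le n-3$. If $G$ is a connected graph of order $n$ with exactly $r$ cut edges whose Sombor index $SO(G)$ is maximum among all connected graphs of order $n$ with exactly $r$ cut edges, then $G$ is isomorphic to the graph obtained by attaching $r$ pendent edges to one vertex of the complete graph $K_{n-r}$.
   Context: For a graph $G$, $d_G(w)$ denotes the degree of vertex $w$, and the Sombor index is $SO(G)=\sum_{ab\in E(G)}\sqrt{d_G(a)^2+d_G(b)^2}$. A cut edge is an edge whose deletion disconnects the graph. $K_m$ denotes the complete graph on $m$ vertices. *)

(* Defs.v *)
From HB Require Import structures.
From mathcomp Require Import all_boot all_order all_fingroup all_algebra.
Set Implicit Arguments. Unset Strict Implicit. Unset Printing Implicit Defensive.
Import Order.TTheory GRing.Theory Num.Theory.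

Definition simple_graph (n : nat) (e : rel 'I_n) : Prop :=
  symmetric e /\ irreflexive e.

Definition graph_connected (n : nat) (e : rel 'I_n) : Prop :=
  forall x y : 'I_n, connect e x y.

Definition deg (n : nat) (e : rel 'I_n) (x : 'I_n) : nat := #|[set y | e x y]|.

Definition del_edge (n : nat) (e : rel 'I_n) (x y : 'I_n) : rel 'I_n :=
  [rel a b : 'I_n | e a b && ~~ (((a == x) && (b == y)) || ((a == y) && (b == x)))].

Definition cut_edge (n : nat) (e : rel 'I_n) (x y : 'I_n) : bool :=
  e x y && ~~ [forall a, forall b, connect (del_edge e x y) a b].

Definition num_cut_edges (n : nat) (e : rel 'I_n) : nat :=
  #|[set p : 'I_n * 'I_n | (p.1 < p.2)%N && cut_edge e p.1 p.2]|.

Definition sombor (R : rcfType) (n : nat) (e : rel 'I_n) : R :=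
  (\sum_(x : 'I_n) \sum_(y : 'I_n | (x < y)%N && e x y)
     Num.sqrt ((deg e x)%:R ^+ 2 + (deg e y)%:R ^+ 2))%R.

(* K_{n-r} on vertices 0..n-r-1 with r pendent edges attached at vertex 0,
   the pendent vertices being n-r..n-1 *)
Definition Kn_pendent (n r : nat) : rel 'I_n :=
  [rel a b : 'I_n | (a != b) &&
     [|| ((a < n - r)%N && (b < n - r)%N),
         ((val a == 0%N) && (n - r <= b)%N) |
         ((val b == 0%N) && (n - r <= a)%N)]].

Definition graph_iso (n : nat) (e1 e2 : rel 'I_n) : Prop :=
  exists f : {perm 'I_n}, forall a b, e1 a b = e2 (f a) (f b).
Arguments Kn_pendent : clear implicits.

(* Main.v *)
Require Import Defs.
From HB Require Import structures.
From mathcomp Require Import all_boot all_order all_fingroup all_algebra.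
From mathcomp Require Import zify ring lra.
Import Order.TTheory GRing.Theory Num.Theory.
Set Implicit Arguments.
Unset Strict Implicit.
Unset Printing Implicit Defensive.

(* Put m = n - r, f(a, b) = sqrt(a^2 + b^2), and let c(v) and d'(v) be the
   numbers of cut and noncut edges at v.  The ends of a cut edge u v have no
   common neighbour, so d(u) + d(v) <= n and its weight is at most
   f(n - 1, 1).  For a noncut edge u v one has d' <= m - 1 and
   c(u) + c(v) <= r, so by convexity of the norm its weight is at most
   f0 + (c(u) + c(v)) / r * (f1 - f0), where f0 = f(m - 1, m - 1) and
   f1 = f(n - 1, m - 1).  Summing over the noncut edges, of which there are at
   most m (m - 1) / 2, and using sum_v c(v) d'(v)
   = sum_(u v cut) (d'(u) + d'(v)) <= r (m - 1), one gets exactly the Sombor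
   index of the clique with r pendent edges at one vertex.  In the equality
   case every cut edge joins degrees n - 1 and 1 and the number of noncut edges
   is m (m - 1) / 2, which determines the graph.
   The counting bounds come from one observation: seen from a root rho, the far
   ends of the r cut edges, together with rho, are r + 1 vertices in pairwise
   distinct components of the graph of noncut edges. *)

(** * Cut edges and their far ends *)

(** Bridge from [sombor] and [num_cut_edges], which run over pairs with x < y, to sums over ordered
    pairs, where the order of summation can be exchanged. *)
Lemma sum_sym_pairs (V : nmodType) (n : nat) (e : rel 'I_n)
    (F : 'I_n -> 'I_n -> V) :
  symmetric e -> irreflexive e -> (forall x y, F x y = F y x) ->
  (\sum_(x : 'I_n) \sum_(y : 'I_n | e x y) F x y
   = (\sum_(x : 'I_n) \sum_(y : 'I_n | (x < y)%N && e x y) F x y) *+ 2)%R.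
Proof.
move=> es ei Fs.
have -> : (\sum_(x : 'I_n) \sum_(y : 'I_n | e x y) F x y =
  \sum_(x : 'I_n) \sum_(y : 'I_n | (x < y)%N && e x y) F x y +
  \sum_(x : 'I_n) \sum_(y : 'I_n | (y < x)%N && e x y) F x y)%R.
  rewrite -big_split /=; apply: eq_bigr => x _.
  rewrite (bigID (fun y : 'I_n => (x < y)%N)) /=; congr (_ + _)%R.
    by apply: eq_bigl => y; rewrite andbC.
  apply: eq_bigl => y; rewrite andbC -leqNgt leq_eqVlt.
  by case: eqP => //= /val_inj ->; rewrite ei andbF.
rewrite mulr2n; congr (_ + _)%R.
rewrite (exchange_big_dep xpredT) //=; apply: eq_bigr => x _.
by apply: eq_big => [y|y _] /=; [rewrite es|rewrite Fs].
Qed.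

Lemma deg_sum (n : nat) (e : rel 'I_n) (x : 'I_n) :
  deg e x = (\sum_y e x y)%N.
Proof.
by rewrite /deg -sum1dep_card big_mkcond; apply: eq_bigr => y _; case: (e x y).
Qed.

Lemma del_edgeE (n : nat) (e : rel 'I_n) (x y a b : 'I_n) :
  del_edge e x y a b =
  e a b && ~~ (((a == x) && (b == y)) || ((a == y) && (b == x))).
Proof. by []. Qed.

Lemma del_edge_sym (n : nat) (e : rel 'I_n) (x y : 'I_n) :
  symmetric e -> symmetric (del_edge e x y).
Proof. by move=> es a b; rewrite !del_edgeE es orbC ![(b == _) && _]andbC. Qed.

Lemma del_edgeC (n : nat) (e : rel 'I_n) (x y : 'I_n) :
  del_edge e x y =2 del_edge e y x.
Proof. by move=> a b; rewrite !del_edgeE orbC. Qed.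

Section CutEdges.
Variables (n : nat) (e : rel 'I_n).
Hypotheses (es : symmetric e) (ei : irreflexive e) (ec : graph_connected e).

Let csym x y : connect_sym (del_edge e x y).
Proof. exact/sym_connect_sym/del_edge_sym. Qed.

(** The vertices reached from [x] or [y] form a set closed under [e], because the only lost edge
    joins two of its members. *)
Lemma del_edge_connect_endpoint (x y a : 'I_n) :
  connect (del_edge e x y) x a || connect (del_edge e x y) y a.
Proof.
pose Q := [pred a |
  connect (del_edge e x y) x a || connect (del_edge e x y) y a].
have clQ : closed e Q.
  apply: intro_closed; first exact: sym_connect_sym.
  move=> {}a b eab; rewrite !inE => Qa.
  have [|ne] := boolP (((a == x) && (b == y)) || ((a == y) && (b == x))).
    by case/orP=> /andP[_ /eqP ->]; rewrite connect0 ?orbT.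
  have dab : connect (del_edge e x y) a b.
    by apply: connect1; rewrite del_edgeE eab.
  by case/orP: Qa => h; rewrite (connect_trans h dab) ?orbT.
have := closed_connect clQ (ec x a); rewrite !inE connect0 /= => <-.
by [].
Qed.

Lemma cut_edgeE (x y : 'I_n) :
  cut_edge e x y = e x y && ~~ connect (del_edge e x y) x y.
Proof.
congr (_ && ~~ _); apply/forallP/idP => [/(_ x)/forallP/(_ y) //|cxy a].
apply/forallP => b.
have to_x z : connect (del_edge e x y) x z.
  case/orP: (del_edge_connect_endpoint x y z) => // h.
  exact: connect_trans cxy h.
by apply: connect_trans (to_x b); rewrite csym.
Qed.

Lemma cut_edge_sym : symmetric (cut_edge e).
Proof.
move=> x y; rewrite !cut_edgeE es csym.
by rewrite (eq_connect (del_edgeC e x y)).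
Qed.

Lemma cut_edge_irr : irreflexive (cut_edge e).
Proof. by move=> x; rewrite cut_edgeE ei. Qed.

Definition noncut_edge : rel 'I_n := [rel x y | e x y && ~~ cut_edge e x y].

Lemma noncut_edgeE (x y : 'I_n) :
  noncut_edge x y = e x y && ~~ cut_edge e x y.
Proof. by []. Qed.

Lemma noncut_edge_sym : symmetric noncut_edge.
Proof. by move=> x y; rewrite !noncut_edgeE es cut_edge_sym. Qed.

Lemma noncut_edge_irr : irreflexive noncut_edge.
Proof. by move=> x; rewrite noncut_edgeE ei. Qed.

Lemma noncut_edge_del (x y a b : 'I_n) :
  cut_edge e x y -> noncut_edge a b -> del_edge e x y a b.
Proof.
move=> cxy /andP[eab ncab]; rewrite del_edgeE eab /=.
apply: contra ncab => /orP[] /andP[/eqP-> /eqP->] //.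
by rewrite cut_edge_sym.
Qed.

(** A component of the noncut edges thus lies entirely on one side of each cut edge. *)
Lemma noncut_connect_del (x y a b : 'I_n) :
  cut_edge e x y -> connect noncut_edge a b -> connect (del_edge e x y) a b.
Proof.
move=> cxy; apply: connect_sub => {}a {}b h.
exact/connect1/noncut_edge_del.
Qed.

Lemma deg_cut_noncut (x : 'I_n) :
  deg e x = (deg (cut_edge e) x + deg noncut_edge x)%N.
Proof.
rewrite /deg -(cardsID [set y | cut_edge e x y]); congr (_ + _).
  by apply: eq_card => y; rewrite !inE cut_edgeE; case: (e x y).
by apply: eq_card => y; rewrite !inE andbC.
Qed.

(** Orientation of the cut edges away from a root: [y] is the end that loses [rho] when the edge is
    deleted. *)
Definition far_end (rho x y : 'I_n) : bool :=
  cut_edge e x y && ~~ connect (del_edge e x y) rho y.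

Lemma far_end_near (rho x y : 'I_n) :
  far_end rho x y -> connect (del_edge e x y) rho x.
Proof.
case/andP=> _ ny; have := del_edge_connect_endpoint x y rho.
by rewrite ![connect _ _ rho]csym (negPf ny) orbF.
Qed.

Lemma far_end_adj (rho x y : 'I_n) :
  connect noncut_edge rho x -> cut_edge e x y -> far_end rho x y.
Proof.
move=> rx cxy; rewrite /far_end cxy /=.
move: (cxy); rewrite cut_edgeE => /andP[_]; apply: contra.
apply: connect_trans; rewrite csym; exact: noncut_connect_del.
Qed.

(** The root still reaches an end of the edge, but not both, as that would reconnect [x] to [y]. The
    booleans are read as numbers so that they can be summed in [card_far_ends]. *)
Lemma cut_edge_far_end (rho x y : 'I_n) :
  (cut_edge e x y : nat) = (far_end rho x y + far_end rho y x)%N.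
Proof.
case cxy : (cut_edge e x y); last first.
  by rewrite /far_end cxy cut_edge_sym cxy.
have cyx : cut_edge e y x by rewrite cut_edge_sym.
rewrite /far_end cxy cyx -(eq_connect (del_edgeC e x y)) /=.
have := del_edge_connect_endpoint x y rho.
rewrite ![connect _ _ rho]csym.
case rx : (connect _ rho x); case ry : (connect _ rho y) => //= _.
move: cxy; rewrite cut_edgeE => /andP[_ /negP[]].
by apply: connect_trans ry; rewrite csym.
Qed.

Lemma far_end_not_noncut_connect (rho x y : 'I_n) :
  far_end rho x y -> ~~ connect noncut_edge rho y.
Proof.
by case/andP=> cxy; apply: contra; exact: noncut_connect_del.
Qed.

(* The near part of [e] minus [x y] cannot use the edge [x' y'], since it
   would then reach [y'], hence [y]; so [x] and then [y] are reachable from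
   [rho] without [x' y']. *)
Lemma far_end_inj (rho x y x' y' : 'I_n) :
  far_end rho x y -> far_end rho x' y' -> connect noncut_edge y y' ->
  x = x' /\ y = y'.
Proof.
move=> f f' yy'.
have /andP[cxy ny] := f; have /andP[cxy' ny'] := f'.
have exy : e x y by case/andP: cxy.
have exy' : e x' y' by case/andP: cxy'.
have [/andP[/eqP-> /eqP->] //|ne1] := boolP ((x == x') && (y == y')).
(* One edge taken in both orientations would have two far ends, against [cut_edge_far_end]. *)
have [/andP[/eqP xy' /eqP yx']|ne2] := boolP ((x == y') && (y == x')).
  have := cut_edge_far_end rho x y; rewrite f cxy.
  by rewrite xy' yx' f'.
set D := del_edge e x y in ny; set D' := del_edge e x' y' in ny'.
have ny2 : ~~ connect D rho y'.
  apply: contra ny => h; apply: (connect_trans h).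
  by rewrite /D csym; apply: noncut_connect_del.
have near_sub a : connect D rho a -> connect D' rho a.
  case/connectP=> p; elim/last_ind: p a => [|p z IH] a /=.
    by move=> _ ->; rewrite connect0.
  rewrite rcons_path last_rcons => /andP[Dp Dz] -> {a}.
  have Dl : connect D rho (last rho p) by apply/connectP; exists p.
  have Dz' : connect D rho z by apply: connect_trans Dl (connect1 Dz).
  apply: connect_trans (IH _ Dp erefl) (connect1 _).
  rewrite /D' del_edgeE; case/andP: Dz => -> _ /=.
  apply/norP; split; apply/andP => -[/eqP h1 /eqP h2].
    by rewrite -h2 Dz' in ny2.
  by rewrite -h1 Dl in ny2.
case/negP: ny'; apply: connect_trans (noncut_connect_del cxy' yy').
apply: connect_trans (near_sub _ (far_end_near f)) (connect1 _).
by rewrite /D' del_edgeE exy negb_or ne1 ne2.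
Qed.

Definition far_ends (rho : 'I_n) : {set 'I_n} :=
  [set y | [exists x, far_end rho x y]].

Lemma sum_deg_cut :
  (\sum_x deg (cut_edge e) x = (num_cut_edges e).*2)%N.
Proof.
have -> : (\sum_x deg (cut_edge e) x = \sum_x \sum_(y | cut_edge e x y) 1)%N.
  by apply: eq_bigr => x _; rewrite sum1dep_card.
rewrite (@sum_sym_pairs nat) //; [|exact: cut_edge_sym|exact: cut_edge_irr].
rewrite mulr2n -addnn.
set a := bigop _ _ _; suff -> : a = num_cut_edges e by [].
by rewrite /a pair_big_dep /= sum1dep_card.
Qed.

(** Each cut edge has exactly one far end, and by [far_end_inj] distinct cut edges have distinct
    ones. Both sides are doubled to compare them with the sum of cut degrees. *)
Lemma card_far_ends (rho : 'I_n) : #|far_ends rho| = num_cut_edges e.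
Proof.
pose F := [set p : 'I_n * 'I_n | far_end rho p.1 p.2].
have -> : far_ends rho = snd @: F.
  apply/setP => y; rewrite inE; apply/existsP/imsetP => [[x fxy]|[[x z]]].
    by exists (x, y); rewrite ?inE.
  by rewrite inE /= => fxz ->; exists x.
rewrite card_in_imset; last first.
  move=> [x y] [x' y']; rewrite !inE /= => f f' yy'; rewrite yy' in f *.
  by have [-> _] := far_end_inj f f' (connect0 _ _).
apply: double_inj; rewrite -sum_deg_cut.
have -> : (#|F| = \sum_x \sum_y far_end rho x y)%N.
  rewrite pair_big_dep /= -sum1dep_card [LHS]big_mkcond.
  by apply: eq_big => // -[x y] _ /=; case: far_end.
transitivity (\sum_x (\sum_y far_end rho x y + \sum_y far_end rho y x))%N.
  by rewrite big_split /= -addnn; congr (_ + _)%N; exact: exchange_big.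
apply: eq_bigr => x _; rewrite -big_split deg_sum.
by apply: eq_bigr => y _; rewrite (cut_edge_far_end rho).
Qed.

Lemma cut_edge_deg (u v : 'I_n) : cut_edge e u v -> (deg e u + deg e v <= n)%N.
Proof.
rewrite cut_edgeE => /andP[euv nc].
rewrite /deg -cardsUI.
have -> : [set y | e u y] :&: [set y | e v y] = set0.
  apply/setP => w; rewrite !inE; apply/negbTE/andP => -[uw vw].
  have wu : w != u by apply: contraTneq uw => ->; rewrite ei.
  have wv : w != v by apply: contraTneq vw => ->; rewrite ei.
  case/negP: nc.
  apply: (@connect_trans _ _ w); apply: connect1; rewrite del_edgeE.
    by rewrite uw (negPf wu) (negPf wv) !andbF.
  by rewrite es vw (negPf wu) (negPf wv).
by rewrite cards0 addn0 -[leqRHS]card_ord max_card.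
Qed.

Lemma far_ends_disjoint_noncut (rho a : 'I_n) :
  connect noncut_edge rho a -> a \notin far_ends rho.
Proof.
move=> ra; rewrite inE; apply/existsP => -[x f].
by move: (far_end_not_noncut_connect f); rewrite ra.
Qed.

Lemma far_ends_noncut_inj (rho y y' : 'I_n) :
  y \in far_ends rho -> y' \in far_ends rho -> connect noncut_edge y y' ->
  y = y'.
Proof.
rewrite !inE => /existsP[x f] /existsP[x' f'] yy'.
by have [_ ->] := far_end_inj f f' yy'.
Qed.

(** With [u] as root, [u] and its noncut neighbours lie in one noncut component, which the far ends
    avoid. *)
Lemma deg_noncut_le (u : 'I_n) : (deg noncut_edge u + num_cut_edges e < n)%N.
Proof.
rewrite -(card_far_ends u) -addSn.
have -> : (deg noncut_edge u).+1 = #|u |: [set y | noncut_edge u y]|.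
  by rewrite cardsU1 inE noncut_edge_irr.
rewrite -cardsUI (_ : _ :&: _ = set0) ?cards0 ?addn0.
  by rewrite -[leqRHS]card_ord max_card.
apply/setP => y; rewrite !in_setI in_set0; apply/negbTE/andP => -[h].
apply/negP/far_ends_disjoint_noncut.
by move: h; rewrite !inE => /orP[/eqP->|h]; rewrite ?connect0 // connect1.
Qed.

(** With [u] as root, [v] is a far end, and the only one in its noncut component. Hence [u] with its
    noncut neighbours, the noncut neighbours of [v], and the far ends are pairwise disjoint. *)
Lemma deg_noncut_cut_edge (u v : 'I_n) : cut_edge e u v ->
  (deg noncut_edge u + deg noncut_edge v + num_cut_edges e < n)%N.
Proof.
move=> cuv; have fv : far_end u u v by apply: far_end_adj.
have Sv : v \in far_ends u by rewrite inE; apply/existsP; exists u.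
rewrite -(card_far_ends u) -addnA -addSn.
have -> : (deg noncut_edge u).+1 = #|u |: [set y | noncut_edge u y]|.
  by rewrite cardsU1 inE noncut_edge_irr.
rewrite -(cardsUI _ (far_ends u)) (_ : _ :&: far_ends u = set0); last first.
  apply/setP => y; rewrite in_setI in_set in_set0.
  apply/negbTE/andP => -[vy Sy].
  have := far_ends_noncut_inj Sv Sy (connect1 vy).
  by move=> vy'; rewrite vy' noncut_edge_irr in vy.
rewrite cards0 addn0 -cardsUI (_ : _ :&: _ = set0) ?cards0 ?addn0.
  by rewrite -[leqRHS]card_ord max_card.
apply/setP => y; rewrite !in_setI in_set0; apply/negbTE/andP => -[h].
have uy : connect noncut_edge u y.
  by move: h; rewrite !inE => /orP[/eqP->|h]; rewrite ?connect0 // connect1.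
rewrite in_setU (negPf (far_ends_disjoint_noncut uy)) orbF in_set => vy.
have := far_end_not_noncut_connect fv; rewrite (connect_trans uy) //.
by apply: connect1; rewrite noncut_edge_sym.
Qed.

(** Both vertices lie in the noncut component of the root [u], so their neighbours along cut edges
    are all far ends, and no far end is counted twice. *)
Lemma deg_cut_noncut_edge (u v : 'I_n) : noncut_edge u v ->
  (deg (cut_edge e) u + deg (cut_edge e) v <= num_cut_edges e)%N.
Proof.
move=> uv; rewrite -(card_far_ends u) /deg -cardsUI.
have fu y : cut_edge e u y -> far_end u u y by apply: far_end_adj.
have fv y : cut_edge e v y -> far_end u v y.
  by apply: far_end_adj; apply: connect1.
rewrite (_ : _ :&: _ = set0) ?cards0 ?addn0; last first.
  apply/setP => y; rewrite !inE; apply/negbTE/andP => -[/fu h /fv h'].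
  have [uv' _] := far_end_inj h h' (connect0 _ _).
  by rewrite uv' noncut_edge_irr in uv.
apply/subset_leq_card/subsetP => y; rewrite !inE => h; apply/existsP.
by case/orP: h => [/fu|/fv] h; [exists u|exists v].
Qed.

(* A vertex outside [S], the [r + 1] pairwise unconnected vertices [rho] and
   the far ends, has at most one noncut neighbour in [S]. *)
Lemma sum_deg_noncut_le :
  (\sum_x deg noncut_edge x
   <= (n - num_cut_edges e) * (n - num_cut_edges e).-1)%N.
Proof.
have [n0|n0] := posnP n.
  by rewrite big1 // => x _; have := ltn_ord x; rewrite [leqRHS]n0.
pose rho := Ordinal n0.
set r := num_cut_edges e; pose S := rho |: far_ends rho.
have Sinj a b : a \in S -> b \in S -> connect noncut_edge a b -> a = b.
  rewrite !in_setU1 => /orP[/eqP->|Sa] /orP[/eqP->|Sb] // h.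
  - by have := far_ends_disjoint_noncut h; rewrite Sb.
  - rewrite (sym_connect_sym noncut_edge_sym) in h.
    by have := far_ends_disjoint_noncut h; rewrite Sa.
  - exact: far_ends_noncut_inj Sa Sb h.
have cS : #|S| = r.+1.
  by rewrite cardsU1 far_ends_disjoint_noncut ?connect0 // card_far_ends.
have cT : #|~: S| = (n - r).-1.
  by have := cardsC S; rewrite card_ord cS; lia.
have toS t : (#|[set y in S | noncut_edge t y]| <= 1)%N.
  apply/card_le1_eqP => a b; rewrite !inE => /andP[Sa ta] /andP[Sb tb].
  apply: Sinj; rewrite ?in_setU1 ?inE //.
  by apply: (@connect_trans _ _ t); apply: connect1; rewrite // noncut_edge_sym.
have degT t : t \in ~: S -> (deg noncut_edge t <= (n - r).-1)%N.
  by move=> _; have := deg_noncut_le t; rewrite -/r; lia.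
(* Counted from the other ends: a vertex outside [S] contributes at most one, a vertex of [S]
   none. *)
have sumS : (\sum_(x in S) deg noncut_edge x <= (n - r).-1)%N.
  rewrite -cT -sum1_card [leqRHS]big_mkcond.
  under eq_bigr do rewrite deg_sum.
  rewrite exchange_big; apply: leq_sum => y _ /=; rewrite inE.
  case: ifP => [_|/negbFE Sy].
    apply: leq_trans (toS y); rewrite -sum1dep_card big_mkcondr /=.
    by apply: leq_sum => x _; rewrite noncut_edge_sym; case: noncut_edge.
  rewrite big1 // => x Sx; apply/eqP; rewrite eqb0; apply/negP => xy.
  by move: (xy); rewrite (Sinj _ _ Sx Sy (connect1 xy)) noncut_edge_irr.
have sumT : (\sum_(t in ~: S) deg noncut_edge t <= (n - r).-1 * (n - r).-1)%N.
  by rewrite -{1}cT -sum_nat_const; apply: leq_sum.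
rewrite (bigID (mem S)) /= [X in (_ + X)%N](eq_bigl (mem (~: S))) => [|x].
  by apply: leq_trans (leq_add sumS sumT) _; case: (n - r)%N => //= p; nia.
by rewrite -in_setC.
Qed.

End CutEdges.

(** * Edge weights *)

Section Hypotenuse.
Variable R : rcfType.
Implicit Types a b c d k r n : nat.
Local Open Scope ring_scope.

Definition hyp a b : R := Num.sqrt (a%:R ^+ 2 + b%:R ^+ 2).

Lemma hypE a b : hyp a b = Num.sqrt ((a ^ 2 + b ^ 2)%N%:R).
Proof. by rewrite /hyp natrD !natrX. Qed.

Lemma hypC a b : hyp a b = hyp b a.
Proof. by rewrite /hyp addrC. Qed.

Lemma hyp_ge0 a b : 0 <= hyp a b.
Proof. exact: sqrtr_ge0. Qed.

Lemma sqr_hyp a b : hyp a b ^+ 2 = a%:R ^+ 2 + b%:R ^+ 2.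
Proof. by rewrite sqr_sqrtr // addr_ge0 ?sqr_ge0. Qed.

Lemma hyp_le a b c d : (a ^ 2 + b ^ 2 <= c ^ 2 + d ^ 2)%N -> hyp a b <= hyp c d.
Proof. by move=> h; rewrite !hypE ler_wsqrtr // ler_nat. Qed.

Lemma hyp_inj a b c d : hyp a b = hyp c d -> (a ^ 2 + b ^ 2 = c ^ 2 + d ^ 2)%N.
Proof.
move/(congr1 (fun x => x ^+ 2)); rewrite !sqr_hyp -!natrX -!natrD => /eqP.
by rewrite eqr_nat => /eqP.
Qed.

Lemma hyp_gt0 a b : (0 < a)%N -> 0 < hyp a b.
Proof. by move=> a0; rewrite hypE sqrtr_gt0 ltr0n addn_gt0 sqrn_gt0 a0. Qed.

Lemma hyp_cauchy_schwarz a b c d :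
  a%:R * c%:R + b%:R * d%:R <= hyp a b * hyp c d.
Proof.
rewrite -(@ler_pXn2r _ 2) ?nnegrE;
  rewrite ?mulr_ge0 ?addr_ge0 ?mulr_ge0 ?ler0n ?hyp_ge0 //.
rewrite exprMn !sqr_hyp.
have := sqr_ge0 (a%:R * d%:R - b%:R * c%:R : R); nra.
Qed.

(* Convexity of the norm on the triangle with vertices [(k, k)], [(k + r, k)]
   and [(k, k + r)]; for [r = 0] the quotient is [0]. *)
Lemma hyp_chord k r a b : (a + b <= r)%N ->
  hyp (k + a) (k + b)
  <= hyp k k + (a + b)%:R / r%:R * (hyp (k + r) k - hyp k k).
Proof.
move=> abr; have [r0|r_gt0] := posnP r.
  have -> : a = 0%N by lia.
  have -> : b = 0%N by lia.
  by rewrite !addn0 mul0r mul0r addr0.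
have r0 : 0 < r%:R :> R by rewrite ltr0n.
set p := (k + a)%N; set q := (k + b)%N.
have [p0|p_gt0] := posnP (p ^ 2 + q ^ 2)%N.
  apply: (@le_trans _ _ 0); first by rewrite hypE p0 sqrtr0.
  rewrite addr_ge0 ?hyp_ge0 // mulr_ge0 ?divr_ge0 ?ler0n // subr_ge0.
  by rewrite hyp_le //; nia.
have N0 : 0 < hyp p q by rewrite hypE sqrtr_gt0 ltr0n.
(* The left side becomes r times the inner product of (p, q) with itself. Since r (p, q) = (r - (a +
   b)) (k, k) + a (k + r, k) + b (k, k + r), the claim is the weighted sum of three Cauchy-Schwarz
   inequalities. *)
rewrite -(ler_pM2l N0) -(ler_pM2l r0).
have h1 := hyp_cauchy_schwarz p q k k.
have h2 := hyp_cauchy_schwarz p q (k + r) k.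
have h3 := hyp_cauchy_schwarz p q k (k + r).
have -> : r%:R * (hyp p q * hyp p q) = r%:R * (p%:R ^+ 2 + q%:R ^+ 2).
  by rewrite -sqr_hyp expr2.
have -> : r%:R * (hyp p q *
    (hyp k k + (a + b)%:R / r%:R * (hyp (k + r) k - hyp k k)))
  = (r - (a + b))%:R * (hyp p q * hyp k k) + a%:R * (hyp p q * hyp (k + r) k)
    + b%:R * (hyp p q * hyp k (k + r)).
  rewrite [hyp k (k + r)]hypC natrB // natrD; field; exact: lt0r_neq0.
have a0 : 0 <= a%:R :> R by [].
have b0 : 0 <= b%:R :> R by [].
have rab0 : 0 <= (r - (a + b))%:R :> R by [].
apply: le_trans (lerD (lerD _ _) (ler_wpM2l b0 h3)); last first.
- exact: ler_wpM2l a0 _ _ h2.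
- exact: ler_wpM2l rab0 _ _ h1.
rewrite /p /q !natrD natrB // natrD le_eqVlt; apply/orP; left; apply/eqP; ring.
Qed.

Lemma hyp_pendent_le n a b : (0 < a)%N -> (0 < b)%N -> (a + b <= n)%N ->
  hyp a b <= hyp n.-1 1.
Proof. by move=> a0 b0 abn; apply: hyp_le; nia. Qed.

Lemma hyp_pendent_eq n a b : (0 < a)%N -> (0 < b)%N -> (a + b <= n)%N ->
  hyp a b = hyp n.-1 1 -> (a = n.-1 /\ b = 1%N) \/ (a = 1%N /\ b = n.-1).
Proof.
case: a b => [//|a] [//|b] _ _ abn /hyp_inj.
(* Now [a] and [b] are one less than the given numbers and [c] is the slack; the equality of squares
   reads 2 a b + c (2 (a + b + 1) + c) = 0. *)
have -> : n.-1 = (a + b + 1 + (n - a.+1 - b.+1))%N by lia.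
move: (n - _ - _)%N => c h.
have ab0 : (a * b = 0)%N by nia.
have c0 : c = 0%N by nia.
by move/eqP: ab0; rewrite muln_eq0 c0 => /orP[]/eqP->; [right|left]; split; lia.
Qed.

End Hypotenuse.

(** * The complete graph with pendent edges at one vertex *)

Section HubGraph.
Variables (n : nat) (u : 'I_n) (S : {set 'I_n}).
Hypotheses (uS : u \notin S) (S3 : (3 <= #|~: S|)%N).

(** The shape of [Kn_pendent] with an arbitrary hub [u] and an arbitrary set [S] of pendent
    vertices, so that it describes both the competitor and the extremal graph. *)
Definition hub_graph : rel 'I_n :=
  [rel a b : 'I_n | (a != b) &&
     [|| (a \notin S) && (b \notin S), (a == u) && (b \in S)
       | (b == u) && (a \in S)]].

Lemma hub_graphE a b : hub_graph a b = (a != b) &&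
     [|| (a \notin S) && (b \notin S), (a == u) && (b \in S)
       | (b == u) && (a \in S)].
Proof. by []. Qed.

Lemma hub_graph_sym : symmetric hub_graph.
Proof.
move=> a b; rewrite !hub_graphE eq_sym; congr (_ && _).
by rewrite andbC [(a == u) && _ || _]orbC.
Qed.

Lemma hub_graph_irr : irreflexive hub_graph.
Proof. by move=> a; rewrite hub_graphE eqxx. Qed.

Lemma hub_graph_hub a : hub_graph u a = (a != u).
Proof.
rewrite hub_graphE eqxx uS eq_sym /=; case: eqP => //= /eqP au.
by case: (a \in S).
Qed.

Lemma hub_graph_connected : graph_connected hub_graph.
Proof.
have cs := sym_connect_sym hub_graph_sym.
have cu a : connect hub_graph u a.
  have [->//|au] := eqVneq a u; apply: connect1; by rewrite hub_graph_hub.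
by move=> a b; apply: connect_trans (cu b); rewrite cs.
Qed.

Lemma hub_graph_pendent a b : a \in S -> hub_graph a b = (b == u).
Proof.
move=> aS; rewrite hub_graphE aS /=.
have -> : (a == u) = false by apply: contraTF aS => /eqP->.
rewrite andbT /=; case: (b =P u) => [->|]; rewrite ?andbT ?andbF //.
by apply: contraTneq aS => ->.
Qed.

Lemma hub_graph_clique a b : a \notin S -> a != u ->
  hub_graph a b = (b \in ~: S :\ a).
Proof.
move=> aS au; rewrite hub_graphE (negPf aS) (negPf au) /= andbF orbF.
by rewrite !inE eq_sym.
Qed.

Lemma deg_hub : deg hub_graph u = n.-1.
Proof.
rewrite /deg -[n in RHS]card_ord -(cardsC1 u).
by apply: eq_card => a; rewrite !inE hub_graph_hub.
Qed.

Lemma deg_hub_pendent a : a \in S -> deg hub_graph a = 1%N.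
Proof.
move=> aS; rewrite /deg -(cards1 u).
by apply: eq_card => b; rewrite !inE hub_graph_pendent.
Qed.

Lemma deg_hub_clique a : a \notin S -> a != u ->
  deg hub_graph a = #|~: S|.-1.
Proof.
move=> aS au; rewrite /deg (cardsD1 a (~: S)) inE aS /=.
by apply: eq_card => b; rewrite inE hub_graph_clique.
Qed.

Lemma cut_edge_hub_graph a b : cut_edge hub_graph a b =
  ((a == u) && (b \in S)) || ((b == u) && (a \in S)).
Proof.
have cE := cut_edgeE hub_graph_sym hub_graph_connected.
have pend y : y \in S -> cut_edge hub_graph u y.
  move=> yS; have yu : y != u by apply: contraTneq yS => ->.
  rewrite cE hub_graph_hub yu /=; apply/negP.
  (* A path is read from [y], whose only edge is the deleted one. *)
  rewrite (sym_connect_sym (del_edge_sym _ _ hub_graph_sym)).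
  case/connectP=> [[_ /= /eqP|z p /andP[+ _] _]].
    by rewrite eq_sym (negPf yu).
  rewrite del_edgeE hub_graph_pendent // eqxx /=.
  by case: (z == u); rewrite //= orbT.
have [/orP[]/andP[/eqP-> h]|ne] := boolP (_ || _).
- exact: pend.
- rewrite (cut_edge_sym hub_graph_sym hub_graph_connected); exact: pend.
apply/negbTE; rewrite cE negb_and negbK orbC; apply/orP.
have [hab|] := boolP (hub_graph a b); last by right.
left; move: (hab); rewrite hub_graphE.
rewrite (negPf ne) orbF => /and3P[ab aS bS].
(* A third clique vertex closes a triangle on [a] and [b], so the edge is not a cut edge; this is
   what [S3] is for. *)
have : (0 < #|~: S :\ a :\ b|)%N.
  move: S3; rewrite (cardsD1 a) (cardsD1 b (_ :\ a)).
  move: #|_| => N; case: (a \in _); case: (b \in _); rewrite ?add0n ?add1n; lia.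
case/card_gt0P => w; rewrite !inE => /and3P[wb wa wS].
apply: (@connect_trans _ _ w); apply: connect1; rewrite del_edgeE hub_graphE.
  by rewrite aS wS (negPf wa) (negPf wb) eq_sym wa !andbF.
by rewrite wS bS (negPf wa) (negPf wb).
Qed.

Lemma num_cut_edges_hub_graph : num_cut_edges hub_graph = #|S|.
Proof.
apply: double_inj; rewrite -sum_deg_cut; [|exact: hub_graph_sym
  |exact: hub_graph_irr|exact: hub_graph_connected].
rewrite (bigD1 u) //= -addnn; congr (_ + _)%N.
  apply: eq_card => y; rewrite inE cut_edge_hub_graph eqxx /=.
  by rewrite (negPf uS) andbF orbF.
rewrite -sum1_card [RHS]big_mkcond /= [LHS]big_mkcond; apply: eq_bigr => x _ /=.
case: ifP => [xu|/negbFE/eqP->]; last by rewrite (negPf uS).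
rewrite deg_sum (bigD1 u) //= big1 => [|y yu].
  by rewrite cut_edge_hub_graph (negPf xu) eqxx /= addn0; case: (x \in S).
by rewrite cut_edge_hub_graph (negPf xu) (negPf yu).
Qed.

(** The terms come from the pendent edges, the clique edges at the hub and the clique edges avoiding
    it, all counted as ordered pairs. *)
Lemma sombor_hub_graph (R : rcfType) : (sombor R hub_graph *+ 2 =
  hyp R n.-1 1 *+ #|S| *+ 2 + hyp R n.-1 #|~: S|.-1 *+ #|~: S|.-1 *+ 2
  + hyp R #|~: S|.-1 #|~: S|.-1 *+ (#|~: S|.-1 * #|~: S|.-2))%R.
Proof.
rewrite /sombor -sum_sym_pairs; [|exact: hub_graph_sym|exact: hub_graph_irr|
  by move=> x y; rewrite addrC].
rewrite -/(hyp R _ _).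
set k := #|~: S|.-1.
have cT : #|~: S :\ u| = k by rewrite /k (cardsD1 u (~: S)) inE uS.
pose F x y := hyp R (deg hub_graph x) (deg hub_graph y).
change (\sum_x \sum_(y | hub_graph x y) F x y =
  hyp R n.-1 1 *+ #|S| *+ 2 + hyp R n.-1 k *+ k *+ 2
  + hyp R k k *+ (k * k.-1))%R.
rewrite (bigD1 u) //= (bigID (mem S)) /= [X in (_ + X = _)%R](bigID (mem S)) /=.
have -> : (\sum_(y | hub_graph u y && (y \in S)) F u y =
    hyp R n.-1 1 *+ #|S|)%R.
  rewrite -sumr_const; apply: eq_big => y; last first.
    by case/andP=> _ yS; rewrite /F deg_hub deg_hub_pendent.
  rewrite hub_graph_hub; case yS : (y \in S); rewrite ?andbF // andbT.
  by apply: contraTneq yS => ->.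
have -> : (\sum_(y | hub_graph u y && (y \notin S)) F u y =
    hyp R n.-1 k *+ k)%R.
  rewrite -[in X in (_ *+ X)%R]cT -sumr_const; apply: eq_big => y; last first.
    by rewrite hub_graph_hub => /andP[yu yS]; rewrite /F deg_hub deg_hub_clique.
  by rewrite hub_graph_hub !inE.
have -> : (\sum_(x | (x != u) && (x \in S)) \sum_(y | hub_graph x y) F x y =
    hyp R n.-1 1 *+ #|S|)%R.
  rewrite -sumr_const; apply: eq_big => x.
    by rewrite andbC; case xS : (x \in S) => //=; apply: contraTneq xS => ->.
  case/andP=> xu xS; rewrite (eq_bigl (pred1 u)) ?big_pred1_eq; last first.
    by move=> y; rewrite hub_graph_pendent.
  by rewrite /F deg_hub deg_hub_pendent // hypC.
have -> : (\sum_(x | (x != u) && (x \notin S)) \sum_(y | hub_graph x y) F x y =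
    (hyp R n.-1 k + hyp R k k *+ k.-1) *+ k)%R.
  rewrite -[in X in (_ *+ X)%R]cT -sumr_const.
  apply: eq_big => x; first by rewrite !inE.
  case/andP=> xu xS; rewrite (bigD1 u) /=; last first.
    by rewrite hub_graph_sym hub_graph_hub.
  rewrite {1}/F deg_hub deg_hub_clique // hypC; congr (_ + _)%R.
  have <- : #|~: S :\ u :\ x| = k.-1.
    by rewrite -cT (cardsD1 x (~: S :\ u)) !inE xu xS.
  rewrite -sumr_const; apply: eq_big => y.
    by rewrite hub_graph_clique // !inE andbCA andbC andbA.
  rewrite hub_graph_clique // !inE => /andP[/andP[yx yS] yu].
  by rewrite /F !deg_hub_clique.
rewrite mulrnDl -mulrnA [(k.-1 * k)%N]mulnC !mulr2n.
by rewrite addrACA addrA addrACA -!addrA.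
Qed.

End HubGraph.

(** * The upper bound and its equality case *)

(** Used in both directions below: for noncut edges weighted by cut degrees and for cut edges
    weighted by noncut degrees. *)
Lemma sum_rel_addw (n : nat) (g : rel 'I_n) (w : 'I_n -> nat) :
  symmetric g ->
  (\sum_x \sum_(y | g x y) (w x + w y) = 2 * \sum_x deg g x * w x)%N.
Proof.
move=> gs.
have h : (\sum_x \sum_(y | g x y) w x = \sum_x deg g x * w x)%N.
  by apply: eq_bigr => x _; rewrite sum_nat_const /deg cardsE.
under eq_bigr do rewrite big_split.
rewrite big_split /= h mul2n -addnn; congr (_ + _)%N; rewrite -h.
rewrite (exchange_big_dep xpredT) //=; apply: eq_bigr => x _.
by apply: eq_bigl => y; rewrite gs.
Qed.

Section UpperBound.
Variables (R : rcfType) (n : nat) (e : rel 'I_n).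
Hypotheses (es : symmetric e) (ei : irreflexive e) (ec : graph_connected e).
Let r := num_cut_edges e.
Let k := (n - r).-1.
Let c := deg (cut_edge e).
Let d' := deg (noncut_edge e).
Let w x y := hyp R (deg e x) (deg e y).
Hypothesis rn : (r < n)%N.

Lemma sombor_split : (sombor R e *+ 2 =
  \sum_x \sum_(y | cut_edge e x y) w x y
  + \sum_x \sum_(y | noncut_edge e x y) w x y)%R.
Proof.
rewrite /sombor -(sum_sym_pairs (F := w)) //; last by move=> x y; apply: hypC.
rewrite -big_split; apply: eq_bigr => x _ /=.
rewrite (bigID (cut_edge e x)) /=; congr (_ + _)%R.
by apply: eq_bigl => y; apply/andb_idl => /andP[].
Qed.

Lemma deg_gt0 x y : e x y -> (0 < deg e x)%N.
Proof. by move=> exy; apply/card_gt0P; exists y; rewrite inE. Qed.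

Lemma weight_cut_le x y : cut_edge e x y -> (w x y <= hyp R n.-1 1)%R.
Proof.
move=> cxy; have /andP[exy _] := cxy.
by apply: hyp_pendent_le (cut_edge_deg es ei ec cxy);
  [apply: deg_gt0 exy|apply: (@deg_gt0 _ x); rewrite es].
Qed.

Lemma weight_noncut_le x y : noncut_edge e x y ->
  (w x y <= hyp R k k + (c x + c y)%:R / r%:R * (hyp R n.-1 k - hyp R k k))%R.
Proof.
move=> nxy; have -> : (n.-1 = k + r)%N by rewrite /k; lia.
(* Raising both noncut degrees to their bound [k] leads to the point (k + c x, k + c y) of the
   triangle in [hyp_chord]. *)
apply: le_trans (hyp_chord R k (deg_cut_noncut_edge es ei ec nxy)).
apply: hyp_le; move: (deg_noncut_le es ei ec y) (deg_noncut_le es ei ec x).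
rewrite !(deg_cut_noncut es ec) -/(c x) -/(c y) => hx hy.
by rewrite leq_add // leq_sqr addnC leq_add2r; move: hx hy; rewrite -/r /k; lia.
Qed.

(* Double counting: [sum c d'] is also a sum over the cut edges, whose ends
   lie in two distinct noncut components. *)
Lemma sum_deg_cut_noncut :
  (\sum_x \sum_(y | noncut_edge e x y) (c x + c y) <= r.*2 * k)%N.
Proof.
rewrite sum_rel_addw; last exact: noncut_edge_sym.
under eq_bigr do rewrite mulnC.
rewrite -(@sum_rel_addw _ (cut_edge e) d'); last exact: cut_edge_sym.
rewrite /r -sum_deg_cut // -/r big_distrl /=; apply: leq_sum => x _.
rewrite /deg -sum1dep_card big_distrl /=; apply: leq_sum => y cxy.
by have := deg_noncut_cut_edge es ei ec cxy; rewrite -/r /d' /k; lia.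
Qed.

Lemma sum_weight_noncut_le :
  (\sum_x \sum_(y | noncut_edge e x y) w x y <=
   hyp R k k *+ (\sum_x d' x)%N + (hyp R n.-1 k - hyp R k k) *+ k *+ 2)%R.
Proof.
set D := (_ - _)%R.
have D0 : (0 <= D)%R.
  by rewrite subr_ge0; apply: hyp_le; rewrite leq_add2r leq_sqr /k; lia.
have -> : (D *+ k *+ 2 = (k * 2)%:R * D)%R by rewrite -mulrnA mulr_natl.
apply: (@le_trans _ _ (\sum_x \sum_(y | noncut_edge e x y)
    (hyp R k k + (c x + c y)%:R / r%:R * D))%R).
  by apply: ler_sum => x _; apply: ler_sum => y; apply: weight_noncut_le.
rewrite (eq_bigr _ (fun x _ => big_split _ _ _ _ _)) big_split /=; apply: lerD.
  rewrite le_eqVlt; apply/orP; left; apply/eqP.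
  rewrite -sumrMnr; apply: eq_bigr => x _.
  by rewrite sumr_const /d' /deg cardsE.
have -> : (\sum_x \sum_(y | noncut_edge e x y) (c x + c y)%:R / r%:R * D =
    (\sum_x \sum_(y | noncut_edge e x y) (c x + c y))%:R / r%:R * D)%R.
  rewrite natr_sum !mulr_suml; apply: eq_bigr => x _.
  by rewrite natr_sum !mulr_suml.
apply: ler_wpM2r => //.
(* For r = 0 the inverse is 0 by convention and the left side vanishes. *)
have [r0|r_gt0] := posnP r; first by rewrite r0 invr0 mulr0.
rewrite ler_pdivrMr ?ltr0n // -natrM ler_nat.
by have := sum_deg_cut_noncut; rewrite -muln2; lia.
Qed.

(** The right side is the value in [sombor_hub_graph]. The weight missing on cut edges and the
    number of missing noncut edges stay on the left, so that equality forces both to vanish. *)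
Lemma sombor_le_deficit : (sombor R e *+ 2
  + \sum_x \sum_(y | cut_edge e x y) (hyp R n.-1 1 - w x y)
  + hyp R k k *+ (k * k.+1 - \sum_x d' x)
  <= hyp R n.-1 1 *+ r *+ 2 + hyp R n.-1 k *+ k *+ 2
     + hyp R k k *+ (k * k.-1))%R.
Proof.
have -> : (\sum_x \sum_(y | cut_edge e x y) (hyp R n.-1 1 - w x y) =
    hyp R n.-1 1 *+ r *+ 2 - \sum_x \sum_(y | cut_edge e x y) w x y)%R.
  rewrite (eq_bigr _ (fun x _ => sumrB _ _ _ _)) sumrB; congr (_ - _)%R.
  rewrite -mulrnA muln2 /r -sum_deg_cut // -sumrMnr; apply: eq_bigr => x _.
  by rewrite sumr_const /deg cardsE.
have Mle : (\sum_x d' x <= k * k.+1)%N.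
  have := sum_deg_noncut_le es ei ec.
  by rewrite -/r -/k /d' /k mulnC prednK; lia.
(* Of the k (k + 1) ordered pairs in a clique of order k + 1, 2 k meet the hub; their [hyp R k k]
   terms cancel those subtracted in [sum_weight_noncut_le]. *)
have kk : (k * k.+1 = k * k.-1 + k * 2)%N by nia.
rewrite sombor_split mulrnBr // kk mulrnDr.
have := sum_weight_noncut_le.
have -> : (hyp R k k *+ (k * 2) = hyp R k k *+ k *+ 2)%R by rewrite mulrnA.
rewrite mulrnBl mulrnBl => h; lra.
Qed.

End UpperBound.

(** * Structure of a graph in which both deficits vanish *)

Section Extremal.
Variables (n : nat) (e : rel 'I_n).
Hypotheses (es : symmetric e) (ei : irreflexive e) (ec : graph_connected e).
Let r := num_cut_edges e.
Hypothesis n3 : (3 <= n)%N.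
Hypothesis cut_pendent : forall x y, cut_edge e x y ->
  (deg e x = n.-1 /\ deg e y = 1%N) \/ (deg e x = 1%N /\ deg e y = n.-1).
Hypothesis noncut_max :
  (\sum_x deg (noncut_edge e) x = (n - r).-1 * (n - r))%N.
Hypothesis rn : (r < n)%N.

Lemma deg1_inj a b b' : deg e a = 1%N -> e a b -> e a b' -> b = b'.
Proof.
move=> da ab ab'; have /card_le1_eqP : (#|[set y | e a y]| <= 1)%N.
  by rewrite -/(deg e a) da.
by apply; rewrite inE.
Qed.

Lemma deg_full_adj a b : deg e a = n.-1 -> b != a -> e a b.
Proof.
move=> da ba; have : [set y | e a y] == [set~ a].
  rewrite eqEcard cardsC1 card_ord -/(deg e a) da leqnn andbT.
  by apply/subsetP => y; rewrite !inE; apply: contraTneq => ->; rewrite ei.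
by move/eqP/setP/(_ b); rewrite !inE ba.
Qed.

(** Take an end of degree n - 1 of some cut edge: it is adjacent to every other vertex, hence is the
    only neighbour of each degree-one end. If there is no cut edge, any vertex will do. *)
Lemma exists_hub : exists u, forall x y, far_end e u x y ->
  x = u /\ deg e y = 1%N.
Proof.
have [|none] := boolP
  [exists u, (deg e u == n.-1) && [exists v, cut_edge e u v]]; last first.
  have n0 : (0 < n)%N by lia.
  exists (Ordinal n0) => x y /andP[cxy _].
  have cyx : cut_edge e y x by rewrite cut_edge_sym.
  case/negP: none; apply/existsP.
  by case: (cut_pendent cxy) => -[dx dy]; [exists x|exists y];
    rewrite (dx, dy) eqxx; apply/existsP; [exists y|exists x].
case/existsP=> u /andP[/eqP du _]; exists u => x y f.
have /andP[cxy ny] := f; have /andP[exy _] := cxy.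
have yu : y != u by apply: contraNneq ny => ->.
case: (cut_pendent cxy) => -[dx dy].
  split=> //; apply: (deg1_inj dy); first by rewrite es.
  by rewrite es; apply: deg_full_adj.
(* Degrees 1 and n - 1 differ because n >= 3. *)
have [xu|xu] := eqVneq x u; first by move: du; rewrite -xu dx; lia.
case/eqP: yu; apply: (deg1_inj dx) => //.
by rewrite es; apply: deg_full_adj.
Qed.

(** Seen from the hub, the far ends are pendent and have no noncut edge. So the maximal sum of
    noncut degrees comes from the n - r other vertices, each of which must attain n - r - 1; they
    form a clique. *)
Lemma extremal_hub_graph : exists u, exists S : {set 'I_n},
  [/\ u \notin S, #|S| = r & e =2 hub_graph u S].
Proof.
have [u hub] := exists_hub.
exists u, (far_ends e u); set S := far_ends e u.
have uS : u \notin S by apply: far_ends_disjoint_noncut.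
have cS : #|S| = r by apply: card_far_ends.
have pend y : y \in S -> cut_edge e u y /\ deg e y = 1%N.
  by rewrite inE => /existsP[x f]; have [<- ->] := hub _ _ f; case/andP: f.
have nS y : y \in S -> deg (noncut_edge e) y = 0%N.
  move=> yS; have [cuy dy] := pend y yS.
  have : (0 < deg (cut_edge e) y)%N.
    by apply/card_gt0P; exists u; rewrite inE cut_edge_sym.
  by have := deg_cut_noncut es ec y; rewrite dy; lia.
have cT : #|~: S| = (n - r)%N.
  by have := cardsC S; rewrite card_ord cS; lia.
have nT x : x \notin S -> deg (noncut_edge e) x = (n - r).-1.
  move=> xS; apply/eqP; rewrite eqn_leq.
  have le y : (deg (noncut_edge e) y <= (n - r).-1)%N.
    by have := deg_noncut_le es ei ec y; rewrite -/r; lia.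
  rewrite le /= leqNgt; apply/negP => lt.
  have : (\sum_(y in ~: S) deg (noncut_edge e) y
          < \sum_(y in ~: S) (n - r).-1)%N.
    have xT : x \in ~: S by rewrite inE.
    rewrite (bigD1 x xT) /=.
    rewrite (bigD1 (P := mem (~: S)) (F := fun=> _) x xT) /= -addSn.
    by apply: leq_add => //; apply: leq_sum.
  rewrite sum_nat_const cT mulnC -noncut_max [X in (_ < X)%N](bigID (mem S)) /=.
  rewrite [X in (_ < X + _)%N]big1 // add0n.
  rewrite (eq_bigl (fun y => y \notin S)) ?ltnn // => y.
  by rewrite inE.
have clique x : x \notin S -> [set y | noncut_edge e x y] = ~: S :\ x.
  move=> xS; apply/eqP; rewrite eqEcard -/(deg _ x) nT //.
  have -> : #|~: S :\ x| = (n - r).-1.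
    by rewrite -cT (cardsD1 x (~: S)) inE xS.
  rewrite leqnn andbT; apply/subsetP => y; rewrite !inE => xy.
  have yS : y \notin S.
    apply/negP => /nS /eqP; rewrite cards_eq0 => /eqP/setP/(_ x).
    by rewrite !inE [noncut_edge e y x]noncut_edge_sym // xy.
  rewrite inE in yS; rewrite yS andbT.
  by apply: contraTneq xy => ->; rewrite noncut_edge_irr.
split=> // a b.
have eS y z : y \in S -> e y z = (z == u).
  move=> yS; have [/andP[euy _] dy] := pend y yS.
  apply/idP/eqP => [yz|->]; last by rewrite es.
  by apply: (deg1_inj dy) => //; rewrite es.
have [aS|aS] := boolP (a \in S); first by rewrite hub_graph_pendent // eS.
have [bS|bS] := boolP (b \in S).
  by rewrite hub_graph_sym es hub_graph_pendent // eS.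
rewrite hub_graphE aS bS /= andbT.
have [->|ab] := eqVneq a b; first exact: ei.
have : b \in [set y | noncut_edge e a y].
  by rewrite clique // in_setD1 in_setC bS eq_sym ab.
by rewrite inE => /andP[].
Qed.

End Extremal.

(** * Relabelling a hub graph as [Kn_pendent] *)

Lemma Kn_pendent_hub_graph (n r : nat) (n0 : (0 < n)%N) : (r < n)%N ->
  Kn_pendent n r =2 hub_graph (Ordinal n0) [set y : 'I_n | (n - r <= y)%N].
Proof.
by move=> rn a b; rewrite hub_graphE /Kn_pendent /= !inE -!ltnNge.
Qed.

Lemma hub_graph_iso (n r : nat) (u : 'I_n) (S : {set 'I_n}) :
  (r < n)%N -> u \notin S -> #|S| = r ->
  graph_iso (hub_graph u S) (Kn_pendent n r).
Proof.
move=> rn uS cS; have n0 : (0 < n)%N by lia.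
(* Vertices are relabelled by their position in [s]: the hub gets 0 and [S] gets exactly the labels
   from n - r on. *)
pose s := u :: enum (~: S :\ u) ++ enum S.
have sE x : x \in s.
  rewrite inE mem_cat !mem_enum !inE.
  by case: (x == u); case: (x \in S).
have us : uniq s.
  rewrite /= mem_cat !mem_enum !inE eqxx (negPf uS) /=.
  rewrite cat_uniq !enum_uniq andbT /=.
  by apply/hasPn => x; rewrite !mem_enum !inE => ->; rewrite andbF.
have cT : #|~: S :\ u| = (n - r).-1.
  have <- : #|~: S| = (n - r)%N by have := cardsC S; rewrite card_ord cS; lia.
  by rewrite (cardsD1 u (~: S)) inE uS.
have ss : size s = n.
  by rewrite /= size_cat -!cardE cT cS; lia.
have ilt x : (index x s < n)%N by rewrite -[ltnRHS]ss index_mem.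
pose f x := Ordinal (ilt x).
have finj : injective f.
  by move=> x y /(congr1 val) /= h; apply: (index_inj u (s := s)).
exists (perm finj) => a b; rewrite !permE.
have f0 x : (f x == Ordinal n0) = (x == u).
  by rewrite -val_eqE /s /= [RHS]eq_sym; case: (u == x).
have fS x : (f x \in [set y : 'I_n | (n - r <= y)%N]) = (x \in S).
  rewrite inE -[(_ <= f x)%N]/(n - r <= index x s)%N /s /=.
  have [<-|ux] := eqVneq u x; first by rewrite (negPf uS) leqn0; lia.
  rewrite index_cat mem_enum !inE eq_sym ux /=.
  case: ifP => [|/negbFE] xS.
    have : (index x (enum (~: S :\ u)) < (n - r).-1)%N.
      by rewrite -cT cardE index_mem mem_enum !inE eq_sym ux.
    rewrite (negPf xS) => lt; apply/negbTE; rewrite -ltnNge.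
    by move: lt; move: (index _ _) => i; lia.
  rewrite xS -cardE cT; move: (index _ _) => i; lia.
rewrite (Kn_pendent_hub_graph n0) // !hub_graphE !fS !f0.
by rewrite (inj_eq finj).
Qed.

Theorem theorem3p7 (R : rcfType) (n r : nat) (e : rel 'I_n) :
  (3 <= n)%N -> (r <= n - 3)%N ->
  simple_graph e -> graph_connected e -> num_cut_edges e = r ->
  (forall e' : rel 'I_n, simple_graph e' -> graph_connected e' ->
     num_cut_edges e' = r -> (sombor R e' <= sombor R e)%R) ->
  graph_iso e (Kn_pendent n r).
Proof.
move=> n3 rn [es ei] ec er emax.
have n0 : (0 < n)%N by lia.
have r_lt : (r < n)%N by lia.
(* The competitor is [Kn_pendent] in its hub form. *)
pose u0 := Ordinal n0; pose S0 := [set y : 'I_n | (n - r <= y)%N].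
have cS0C : #|~: S0| = (n - r)%N.
  have -> : ~: S0 = [set widen_ord (leq_subr r n) i | i : 'I_(n - r)].
    apply/setP => y; rewrite !inE -ltnNge; apply/idP/imsetP => [lt|[i _ ->]].
      by exists (Ordinal lt) => //; apply: val_inj.
    by rewrite /=.
  by rewrite card_imset ?card_ord // => i j /(congr1 val) /= /val_inj.
have cS0 : #|S0| = r by have := cardsC S0; rewrite card_ord cS0C; lia.
have uS0 : u0 \notin S0 by rewrite inE /=; lia.
have S03 : (3 <= #|~: S0|)%N by rewrite cS0C; lia.
have := emax (hub_graph u0 S0).
have -> : num_cut_edges (hub_graph u0 S0) = r.
  by rewrite num_cut_edges_hub_graph.
have hs := hub_graph_sym u0 S0; have hi := hub_graph_irr u0 S0.
have hc := hub_graph_connected uS0.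
move=> /(_ (conj hs hi) hc erefl) Hle.
have r_lt' : (num_cut_edges e < n)%N by rewrite er.
have := sombor_le_deficit R es ei ec r_lt'; rewrite er.
have := sombor_hub_graph uS0 R; rewrite cS0 cS0C => <-.
set k := (n - r).-1.
(* [C] and [M] are the two deficits. The competitor attains the bound, so maximality of [e] leaves
   no room for either. *)
set C := (\sum_x _)%R; set M := (_ - _)%N => Hdef.
(* Here k >= 2; positivity lets [M] be cancelled out of a vanishing multiple. *)
have f0 : (0 < hyp R k k)%R by apply: hyp_gt0; rewrite /k; lia.
have C0 : (0 <= C)%R.
  apply: sumr_ge0 => x _; apply: sumr_ge0 => y cxy.
  by rewrite subr_ge0; apply: weight_cut_le.
have M0 : (0 <= hyp R k k *+ M)%R by rewrite mulrn_wge0 // ltW.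
have Hle2 : (sombor R (hub_graph u0 S0) *+ 2 <= sombor R e *+ 2)%R.
  by rewrite ler_wMn2r.
have Ceq : C = 0%R by lra.
have Meq : (hyp R k k *+ M = 0)%R by lra.
(* The subtraction in [M] is truncated, so M = 0 yields equality only together with this upper
   bound. *)
have Mle := sum_deg_noncut_le es ei ec; rewrite er in Mle.
have {Meq} Mmax : (\sum_x deg (noncut_edge e) x = (n - r).-1 * (n - r))%N.
  move/eqP: Meq; rewrite mulrn_eq0 (gt_eqF f0) orbF /M => /eqP.
  by move: Mle; rewrite mulnC /k prednK; lia.
have cut_pendent x y : cut_edge e x y ->
    (deg e x = n.-1 /\ deg e y = 1%N) \/ (deg e x = 1%N /\ deg e y = n.-1).
  move=> cxy; have /andP[exy _] := cxy.
  apply: (@hyp_pendent_eq R); [exact: deg_gt0 exy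
    |by apply: (@deg_gt0 _ _ _ x); rewrite es|exact: cut_edge_deg|].
  have ge0 a b : cut_edge e a b ->
      (0 <= hyp R n.-1 1 - hyp R (deg e a) (deg e b))%R.
    by move=> cab; rewrite subr_ge0; apply: weight_cut_le.
  move/eqP: Ceq; rewrite psumr_eq0; last first.
    by move=> a _; apply: sumr_ge0 => b; apply: ge0.
  move/allP/(_ x (mem_index_enum _)); rewrite /= psumr_eq0; last first.
    by move=> b; apply: ge0.
  by move/allP/(_ y (mem_index_enum _)); rewrite cxy /= subr_eq0 => /eqP.
rewrite -er in Mmax.
have [u [S [uS cS eE]]] :=
  extremal_hub_graph es ei ec n3 cut_pendent Mmax r_lt'.
rewrite er in cS; have [f fE] := hub_graph_iso r_lt uS cS.
by exists f => a b; rewrite eE fE.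
Qed.
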